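(* Let $\mathbb{F}$ be a field, $A=\mathbb{F}\times\mathbb{F}$ and $B=\mathbb{F}\times\{0\}$ (an ideal of $A$, with multiplicative identity $1_B=(1,0)$). Put $$S=\begin{pmatrix} A & A & B \\ A & A & B \\ B & B & A \end{pmatrix},\quad R=\begin{pmatrix} A & A & 0 \\ A & A & 0 \\ 0 & 0 & A \end{pmatrix},\quad T=\begin{pmatrix} 0 & 0 & B \\ 0 & 0 & B \\ B & B & 0 \end{pmatrix}$$ inside $M_3(A)$, and regard $S$ as an (epsilon-strongly) $\mathbb{Z}_2$-graded ring with $S_0=R$ and $S_1=T$. Then $\mathrm{tr}_\gamma(1_R)$ is invertible in $R$ if and only if $\mathrm{char}(\mathbb{F})\neq2$.
   Context: Matrix notation means the set of all $3\times3$ matrices with entries in the indicated sets. $XY$ denotes the set of finite sums of products $xy$ with $x \in X$, $y\in Y$; $Z(R)$ is the center of $R$. Let $G$ be a group with identity $e$ (here $G=\mathbb{Z}_2$, written additively, $e=0$). A $G$-graded ring $S=\bigoplus_{g\in G}S_g$ (additive subgroups $S_g$ with $S_gS_h\subseteq S_{gh}$), with $R=S_e$, is epsilon-strongly graded by $G$ if for each $g\in G$, $S_gS_{g^{-1}}$ is an ideal of $R$ having its own multiplicative identity element $\epsilon_g$ (possibly $0$), and for all $g,h\in G$: $S_gS_h=S_gS_{g^{-1}}S_{gh}=S_{gh}S_{h^{-1}}S_h$. The $\mathbb{Z}_2$-grading in the claim is epsilon-strong. For each $g\in G$ fix $n_g\in\{1,2,\ldots\}$ and elements $u_g^{(i)}\in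 S_g$, $v_{g^{-1}}^{(i)}\in S_{g^{-1}}$, $1\le i\le n_g$, with $\sum_{i=1}^{n_g}u_g^{(i)}v_{g^{-1}}^{(i)}=\epsilon_g$ (with $n_e=1$, $u_e^{(1)}=v_e^{(1)}=1$), and define $\gamma_g(s)=\sum_{i=1}^{n_g}u_g^{(i)}sv_{g^{-1}}^{(i)}$ for $s\in S$. (On $Z(R)$, $\gamma_g$ does not depend on the choices and takes values in $Z(R)$.) For finite $G$, $\mathrm{tr}_\gamma:Z(R)\to Z(R)$ is $\mathrm{tr}_\gamma(r)=\sum_{g\in G}\gamma_g(r)$. $1_R$ is the identity of $R$. *)

(* Defs.v *)
From HB Require Import structures.
From mathcomp Require Import all_boot all_order all_algebra all_fingroup.
From mathcomp Require Import classical_sets.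

Set Implicit Arguments.
Unset Strict Implicit.
Unset Printing Implicit Defensive.

Import GRing.Theory.
Local Open Scope classical_set_scope.
Local Open Scope ring_scope.

Section Subsets.
Variable S : pzRingType.
Implicit Types X Y I R : set S.

Definition is_additive_subgroup X : Prop :=
  X 0 /\ forall x y, X x -> X y -> X (x - y).

(* Finite sums of products, not the pointwise product of sets. *)
Definition set_prod X Y : set S :=
  [set s | exists n (x y : 'I_n -> S),
     [/\ forall i, X (x i), forall i, Y (y i) & s = \sum_i x i * y i]].

Definition is_ideal_of R I : Prop :=
  [/\ I `<=` R, is_additive_subgroup I &
      forall r x, R r -> I x -> I (r * x) /\ I (x * r)].

Definition is_identity_of X (e : S) : Prop :=
  X e /\ forall x, X x -> e * x = x /\ x * e = x.

(* For subrings X containing 1. *)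
Definition invertible_in X (x : S) : Prop :=
  X x /\ exists2 y, X y & x * y = 1 /\ y * x = 1.

End Subsets.

Infix "⊙" := set_prod (at level 40, left associativity).

Section Gradings.
Variables (G : finGroupType) (S : pzRingType) (Sg : G -> set S).

Record is_grading : Prop := {
  grading_additive : forall g, is_additive_subgroup (Sg g);
  grading_direct_sum : forall s : S, exists! f : {ffun G -> S},
    (forall g, Sg g (f g)) /\ s = \sum_g f g;
  grading_mul : forall g h, Sg g ⊙ Sg h `<=` Sg (g * h)%g }.

Record is_epsilon_strong_grading : Prop := {
  epsilon_grading : is_grading;
  epsilon_ideal : forall g, is_ideal_of (Sg 1%g) (Sg g ⊙ Sg g^-1%g);
  epsilon_identity : forall g, exists e, is_identity_of (Sg g ⊙ Sg g^-1%g) e;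
  epsilon_mull : forall g h,
    Sg g ⊙ Sg h = Sg g ⊙ Sg g^-1%g ⊙ Sg (g * h)%g;
  epsilon_mulr : forall g h,
    Sg g ⊙ Sg h = Sg (g * h)%g ⊙ Sg h^-1%g ⊙ Sg h }.

(* [u g i] and [v g i] stand for u_g^(i) in S_g and v_{g^-1}^(i) in S_{g^-1}:
   the second family is indexed by g, not by g^-1. *)
Record is_epsilon_decomposition (eps : G -> S) (n : G -> nat)
    (u v : forall g, 'I_(n g) -> S) : Prop := {
  decomposition_identity : forall g,
    is_identity_of (Sg g ⊙ Sg g^-1%g) (eps g);
  decomposition_size : forall g, (0 < n g)%N;
  decomposition_memu : forall g i, Sg g (u g i);
  decomposition_memv : forall g i, Sg g^-1%g (v g i);
  decomposition_sum : forall g, \sum_i u g i * v g i = eps g;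
  decomposition_size1 : n 1%g = 1%N;
  decomposition_u1 : forall i, u 1%g i = 1;
  decomposition_v1 : forall i, v 1%g i = 1 }.

End Gradings.

Section Trace.
Variables (G : finGroupType) (S : pzRingType).

Definition gamma (n : G -> nat) (u v : forall g, 'I_(n g) -> S)
  (g : G) (s : S) : S := \sum_i u g i * s * v g i.

(* Defined on all of S; the trace map proper is its restriction to the center
   of the degree-1 component. *)
Definition tr_gamma (n : G -> nat) (u v : forall g, 'I_(n g) -> S)
  (r : S) : S := \sum_g gamma u v g r.

End Trace.

Section Example.
Variable F : fieldType.

Definition A : comNzRingType := (F * F)%type.
Definition inA : {pred A} := predT.
Definition inB : {pred A} := [pred a | a.2 == 0].
Definition in0 : {pred A} := pred1 0.

Definition mx_pattern (X : seq (seq {pred A})) : {pred 'M[A]_3} :=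
  [pred M : 'M[A]_3 |
     [forall i, forall j, M i j \in nth in0 (nth [::] X i) j]].

Definition Spat : {pred 'M[A]_3} := mx_pattern
  [:: [:: inA; inA; inB];
      [:: inA; inA; inB];
      [:: inB; inB; inA]].

Definition Rpat : {pred 'M[A]_3} := mx_pattern
  [:: [:: inA; inA; in0];
      [:: inA; inA; in0];
      [:: in0; in0; inA]].

Definition Tpat : {pred 'M[A]_3} := mx_pattern
  [:: [:: in0; in0; inB];
      [:: in0; in0; inB];
      [:: inB; inB; in0]].

Lemma SpatP (M : 'M[A]_3) :
  reflect (forall i j : 'I_3, (i == 2%N :> nat) != (j == 2%N :> nat) ->
             (M i j).2 = 0)
          (M \in Spat).
Proof.
apply: (iffP forallP) => /= [H i j ij | H i].
  have /forallP /(_ j) := H i.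
  by case: i j ij {H} => [[|[|[|//]]] ?] [[|[|[|//]]] ?] //= _ /eqP.
apply/forallP => j; have := H i j.
by case: i j {H} => [[|[|[|//]]] ?] [[|[|[|//]]] ?] //= /(_ isT) /eqP.
Qed.

Lemma Spat_subring : subring_closed Spat.
Proof.
split=> [|M N /SpatP HM /SpatP HN|M N /SpatP HM /SpatP HN]; apply/SpatP => i j ij.
- by rewrite mxE; case: eqP => // eij; rewrite eij eqxx in ij.
- by rewrite !mxE /= HM // HN // subrr.
- rewrite mxE raddf_sum big1 // => k _ /=.
  have [ik|/negPn/eqP ik] := boolP ((i == 2%N :> nat) != (k == 2%N :> nat)).
    by rewrite HM // mul0r.
  by rewrite HN ?mulr0 // -ik.
Qed.

HB.instance Definition _ := GRing.isSubringClosed.Build 'M[A]_3 Spat Spat_subring.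

Record Smx : Type := MkSmx { mx_of_Smx : 'M[A]_3; _ : mx_of_Smx \in Spat }.

HB.instance Definition _ := [isSub for mx_of_Smx].
HB.instance Definition _ := [Choice of Smx by <:].
HB.instance Definition _ := [SubChoice_isSubNzRing of Smx by <:].

Definition Rset : set Smx := [set s | val s \in Rpat].
Definition Tset : set Smx := [set s | val s \in Tpat].

(* The group structure on 'Z_2 is the additive one, with neutral element 0. *)
Definition Sgrading (g : 'Z_2) : set Smx := if g == 0 then Rset else Tset.

End Example.

(* Main.v *)
Require Import Defs.
From mathcomp Require Import all_boot all_order all_algebra all_fingroup.
From mathcomp Require Import classical_sets.
Local Open Scope ring_scope.

Set Implicit Arguments.
Unset Strict Implicit.
Unset Printing Implicit Defensive.

Import GRing.Theory.

(** A grading is epsilon-strong as soon as every S_g S_(g^-1) contains an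
    element eps_g that acts as an identity on S_g from the left and on
    S_(g^-1) from the right ([epsilon_strongI]). Such an eps_g is the identity
    of S_g S_(g^-1), hence it is the value of gamma_g at 1 for every choice of
    the u's and v's, and the trace of 1 is the sum of the eps_g
    ([tr_gamma1]).

    In the example, number the rows and columns by 0, 1, 2 and give degree 1 to
    index 2 and degree 0 to the others. The component S_g consists of the
    elements of S whose entries of degree different from g vanish, where the
    degree of entry (i, j) is the difference of the degrees of i and j
    ([SgradingP]); this is why S is graded. The scalar matrices eps_0 = 1_A and
    eps_1 = 1_B satisfy the criterion: entries of degree 1 lie in B, and the
    products of opposite matrix units of degree 1 are the 1_B E_kk
    ([Seps_prod]).

    So the trace of 1 is the scalar matrix 1_A + 1_B = (2, 1), which is
    invertible in R exactly when 2 is nonzero in F. *)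

(** * Sums of products of additive subsets *)

Section AdditiveSubsets.
Variable S : pzRingType.
Implicit Types (X Y Z : set S) (x y z : S).

Lemma additive0 X : is_additive_subgroup X -> X 0.
Proof. by case. Qed.

Lemma additiveN X x : is_additive_subgroup X -> X x -> X (- x).
Proof. by case=> X0 XB Xx; rewrite -[- x]add0r; exact: XB. Qed.

Lemma additiveD X x y : is_additive_subgroup X -> X x -> X y -> X (x + y).
Proof.
by move=> aX Xx Xy; rewrite -[y]opprK; apply aX.2 => //; exact: additiveN.
Qed.

Lemma additive_sum X (I : finType) (f : I -> S) :
  is_additive_subgroup X -> (forall i, X (f i)) -> X (\sum_i f i).
Proof.
move=> aX Xf; elim/big_ind: _ => [|x y Xx Xy|//]; first exact: additive0.
exact: additiveD.
Qed.

Lemma mem_set_prod X Y x y : X x -> Y y -> (X ⊙ Y) (x * y).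
Proof.
by move=> Xx Yy; exists 1%N, (fun=> x), (fun=> y); split=> //; rewrite big_ord1.
Qed.

(** Differences are obtained by changing signs in the left factors. *)
Lemma set_prod_additive X Y :
  is_additive_subgroup X -> is_additive_subgroup (X ⊙ Y).
Proof.
move=> aX; split=> [|_ _ [n [x [y [Xx Yy ->]]]] [m [x' [y' [Xx' Yy' ->]]]]].
  by exists 0%N, (fun=> 0), (fun=> 0); split=> [[]|[]|] //; rewrite big_ord0.
exists (n + m)%N,
  (fun k => match split k with inl i => x i | inr j => - x' j end),
  (fun k => match split k with inl i => y i | inr j => y' j end).
split=> [k|k|].
- by case: split => // j; exact: additiveN.
- by case: split.
rewrite big_split_ord /= -sumrN; congr (_ + _); apply: eq_bigr => i _.
  by rewrite (unsplitK (inl i)).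
by rewrite (unsplitK (inr i)) mulNr.
Qed.

Lemma set_prod_sub X Y Z : is_additive_subgroup Z ->
  (forall x y, X x -> Y y -> Z (x * y)) -> (X ⊙ Y `<=` Z)%classic.
Proof.
move=> aZ XYZ _ [n [x [y [Xx Yy ->]]]].
by apply: additive_sum => // i; exact: XYZ.
Qed.

Lemma additive_mulr_preim X t :
  is_additive_subgroup X -> is_additive_subgroup (fun x => X (x * t)).
Proof.
move=> [X0 XB]; split=> [|x y Xx Xy]; first by rewrite mul0r.
by rewrite mulrBl; exact: XB.
Qed.

(** Applied to the identities of one and the same ideal, this makes the choice
    of the elements in an epsilon-decomposition irrelevant for the trace of 1. *)
Lemma identity_of_uniq X e e' :
  is_identity_of X e -> is_identity_of X e' -> e = e'.
Proof. by move=> [Xe He] [Xe' He']; rewrite -(He' _ Xe).1 (He _ Xe').2. Qed.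

End AdditiveSubsets.

(** * Epsilon-strong gradings from local units *)

Section Criterion.
Variables (G : finGroupType) (S : pzRingType) (Sg : G -> set S) (eps : G -> S).
Hypothesis grS : is_grading Sg.
Hypothesis eps_prod : forall g, (Sg g ⊙ Sg g^-1%g) (eps g).
Hypothesis eps_mull : forall g s, Sg g s -> eps g * s = s.
Hypothesis eps_mulr : forall g s, Sg g s -> s * eps g^-1%g = s.

Let aS g : is_additive_subgroup (Sg g). Proof. exact: grading_additive. Qed.

Let mulS g h k s t : (g * h)%g = k -> Sg g s -> Sg h t -> Sg k (s * t).
Proof. by move=> <- ? ?; apply: grading_mul => //; exact: mem_set_prod. Qed.

(** Multiplication by eps g from the left fixes the left factors of the
    products, and from the right their right factors. *)
Lemma epsilon_is_identity g : is_identity_of (Sg g ⊙ Sg g^-1%g) (eps g).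
Proof.
split=> // _ [n [x [y [Sx Sy ->]]]]; rewrite mulr_sumr mulr_suml.
split; apply: eq_bigr => i _; first by rewrite mulrA eps_mull.
by rewrite -mulrA -[g in eps g]invgK eps_mulr.
Qed.

(** Local units of the homogeneous components suffice: the ideal
    S_g S_(g^-1) absorbs R because S_g and S_(g^-1) are R-modules, and in
    both product identities the inclusion from left to right inserts
    a sum of products into s t, through s t = eps_g s t for the first identity
    and s t = s t eps_(h^-1) for the second, while the inclusion from right to
    left only adds up degrees. *)
Lemma epsilon_strongI : is_epsilon_strong_grading Sg.
Proof.
have aP g h : is_additive_subgroup (Sg g ⊙ Sg h) by exact: set_prod_additive.
split=> // [g|g|g h|g h].
- split=> [||r x Rr [n [a [b [Sa Sb ->]]]]] //.
    by rewrite -(mulgV g); exact: grading_mul.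
  rewrite mulr_sumr mulr_suml.
  split; apply: additive_sum => // i; [rewrite mulrA | rewrite -mulrA].
    by apply: mem_set_prod => //; apply: mulS Rr (Sa i); rewrite mul1g.
  by apply: mem_set_prod => //; apply: mulS (Sb i) Rr; rewrite mulg1.
- by exists (eps g); exact: epsilon_is_identity.
- apply/seteqP; split; apply: set_prod_sub => [|s t Ss St].
  + exact: set_prod_additive.
  + rewrite -(eps_mull Ss) -mulrA.
    by apply: mem_set_prod => //; exact: mulS Ss St.
  + exact: aP.
  + (* here s is itself a sum of products, so induct on it with t fixed *)
    apply: (set_prod_sub (additive_mulr_preim t (aP g h))) Ss => a b Sa Sb.
    rewrite -mulrA; apply: mem_set_prod => //.
    by apply: mulS Sb St; rewrite mulKg.
- apply/seteqP; split; apply: set_prod_sub => [|s t Ss St].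
  + by do 2!apply: set_prod_additive.
  + rewrite -(eps_mulr St); have [n [a [b [Sa Sb ->]]]] := eps_prod h^-1%g.
    rewrite invgK in Sb.
    rewrite !mulr_sumr; apply: additive_sum => [|i].
      by do 2!apply: set_prod_additive.
    rewrite !mulrA; apply: mem_set_prod => //; apply: mem_set_prod => //.
    exact: mulS Ss St.
  + exact: aP.
  + apply: (set_prod_sub (additive_mulr_preim t (aP g h))) Ss => a b Sa Sb.
    apply: mem_set_prod => //.
    by apply: mulS Sa Sb; rewrite mulgK.
Qed.

(** The trace of 1 collapses to the sum of the local units, since
    gamma_g(1) = sum_i u_i v_i. *)
Lemma tr_gamma1 (eps' : G -> S) (n : G -> nat) (u v : forall g, 'I_(n g) -> S) :
  is_epsilon_decomposition Sg eps' u v -> tr_gamma u v 1 = \sum_g eps g.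
Proof.
move=> dec; apply: eq_bigr => g _.
rewrite (identity_of_uniq (epsilon_is_identity g) (decomposition_identity dec g)).
by rewrite -(decomposition_sum dec); apply: eq_bigr => i _; rewrite mulr1.
Qed.

End Criterion.

(** * The grading of the matrix ring *)

Section Example.
Variable F : fieldType.
Implicit Types (s t : Smx F) (i j k : 'I_3) (g h : 'Z_2) (a b : A F).

Definition rowdeg i : 'Z_2 := if i == 2%N :> nat then 1 else 0.
Definition entrydeg i j : 'Z_2 := (rowdeg i * (rowdeg j)^-1)%g.

Lemma entrydegM i k j : (entrydeg i k * entrydeg k j)%g = entrydeg i j.
Proof. by rewrite /entrydeg mulgA mulgKV. Qed.

Lemma entrydegV i j : ((entrydeg i j)^-1)%g = entrydeg j i.
Proof. by rewrite /entrydeg invMg invgK. Qed.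

Lemma entrydeg_eq0 i j :
  (entrydeg i j == 0) = ((i == 2%N :> nat) == (j == 2%N :> nat)).
Proof. by rewrite /entrydeg /rowdeg; do 2!case: (_ == 2%N). Qed.

Lemma Z2_cases g : g = 0 \/ g = 1.
Proof. by case: g => [[|[|//]]] ?; [left|right]; apply: val_inj. Qed.

Lemma Z2_invg g : (g^-1)%g = g.
Proof. by case: (Z2_cases g) => ->; apply: val_inj. Qed.

(** Both components are cut out of S by the vanishing of the entries of the
    wrong degree: the remaining condition in T, that the entries of degree 1 lie
    in B, holds throughout S. This is what allows one argument for both components. *)
Lemma SgradingP g s :
  Sgrading g s <-> forall i j, entrydeg i j != g -> val s i j = 0.
Proof.
have Ss := SpatP _ (valP s).
case: (Z2_cases g) => ->; rewrite /Sgrading /=; split=> [/forallP H i j|H].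
- move: (forallP (H i) j) => {H Ss}; rewrite entrydeg_eq0.
  by case: i j => [[|[|[|//]]] ?] [[|[|[|//]]] ?] //= /eqP.
- apply/forallP => i; apply/forallP => j; move: (H i j) => {H Ss}.
  rewrite entrydeg_eq0.
  by case: i j => [[|[|[|//]]] ?] [[|[|[|//]]] ?] //= /(_ isT) /eqP.
- move: (forallP (H i) j) => {H Ss}.
  by case: i j => [[|[|[|//]]] ?] [[|[|[|//]]] ?] //= /eqP.
apply/forallP => i; apply/forallP => j; move: (H i j) (Ss i j) => {H Ss}.
by case: i j => [[|[|[|//]]] ?] [[|[|[|//]]] ?] //= H1 H2;
  apply/eqP; first [exact: H1 | exact: H2].
Qed.

Lemma valM s t : val (s * t) = val s *m val t.
Proof. exact: rmorphM. Qed.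

Lemma val_sum (I : finType) (f : I -> Smx F) :
  val (\sum_i f i) = \sum_i val (f i).
Proof. exact: raddf_sum. Qed.

(** Products of entries add degrees, and a matrix is the sum of its
    homogeneous parts, obtained by sorting the entries by degree. *)
Lemma Sgrading_is_grading : is_grading (@Sgrading F).
Proof.
have aS g : is_additive_subgroup (@Sgrading F g).
  split=> [|s t /SgradingP Ss /SgradingP St]; apply/SgradingP => i j ij.
    by rewrite mxE.
  by rewrite raddfB !mxE Ss // St // subrr.
split=> [//|s|g h]; last first.
  apply: set_prod_sub => // s t /SgradingP Ss /SgradingP St.
  apply/SgradingP => i j ij; rewrite valM mxE big1 // => k _.
  have [ik|/Ss->] := eqVneq (entrydeg i k) g; last by rewrite mul0r.
  rewrite St ?mulr0 //; apply: contra_neq ij => kj.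
  by rewrite -(entrydegM i k j) ik kj.
pose M g : 'M[A F]_3 := \matrix_(i, j) (val s i j *+ (entrydeg i j == g)).
have MS g : M g \in @Spat F.
  apply/SpatP => i j ij; rewrite mxE.
  by case: eqP => //= _; exact: (SpatP _ (valP s)).
exists [ffun g => MkSmx (MS g)]; split=> [|f [Sf def_s]].
  split=> [g|].
    by apply/SgradingP => i j; rewrite ffunE mxE => /negPf->.
  apply: val_inj; apply/matrixP => i j; rewrite val_sum summxE.
  rewrite (bigD1 (entrydeg i j)) //= ffunE mxE eqxx big1 ?addr0 // => g ij.
  by rewrite ffunE mxE eq_sym (negPf ij).
apply/ffunP => g; rewrite ffunE; apply: val_inj; apply/matrixP => i j.
rewrite mxE; have [<-|ij] := eqVneq; last first.
  by have /SgradingP -> := Sf g.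
rewrite def_s val_sum summxE (bigD1 (entrydeg i j)) //= big1 ?addr0 // => h.
by rewrite eq_sym => ij; have /SgradingP -> := Sf h.
Qed.

(** * Local units and the trace *)

(** The identity of the ideal of A in which the entries of degree g lie:
    1_A for g = 0, and 1_B otherwise. *)
Definition entry1 g : A F := (1, (g == 0)%:R).

Lemma entry1_idem g : entry1 g * entry1 g = entry1 g.
Proof. by congr pair => /=; rewrite ?mulr1 // -natrM mulnb andbb. Qed.

Lemma Spat_scalar a : a%:M \in @Spat F.
Proof.
apply/SpatP => i j ij; rewrite mxE; case: eqP => // eij.
by rewrite eij eqxx in ij.
Qed.

Definition Sscalar a : Smx F := MkSmx (Spat_scalar a).

Lemma Sscalar_R a : Rset (Sscalar a).
Proof.
rewrite -[Rset _]/(Sgrading 0 _); apply/SgradingP => i j ij; rewrite mxE.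
by case: (i =P j) ij => // ->; rewrite /entrydeg mulgV.
Qed.

Lemma Sscalar1 : Sscalar 1 = 1.
Proof. exact: val_inj. Qed.

Lemma SscalarM a b : Sscalar a * Sscalar b = Sscalar (a * b).
Proof. by apply: val_inj; rewrite valM -scalar_mxM. Qed.

Lemma Spat_unit i j : entry1 (entrydeg i j) *: delta_mx i j \in @Spat F.
Proof.
apply/SpatP => i' j' ij; rewrite !mxE.
case: andP ij => [[/eqP-> /eqP->]|_ _]; last by rewrite mulr0.
by rewrite /= entrydeg_eq0 => /negPf->; rewrite mul0r.
Qed.

(** The coefficient is the largest idempotent of A for which this multiple of
    the matrix unit E_ij lies in S. *)
Definition Sunit i j : Smx F := MkSmx (Spat_unit i j).

Lemma Sunit_deg g i j : entrydeg i j = g -> Sgrading g (Sunit i j).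
Proof.
move=> <-; apply/SgradingP => i' j' ij; rewrite !mxE.
by case: andP ij => [[/eqP-> /eqP->]|]; rewrite ?eqxx // mulr0.
Qed.

Definition Seps g : Smx F := Sscalar (entry1 g).

Lemma entry1_entry g s i j : Sgrading g s -> entry1 g * val s i j = val s i j.
Proof.
move=> /SgradingP Ss; have [ij|/Ss->] := eqVneq (entrydeg i j) g; last first.
  exact: mulr0.
rewrite [LHS]surjective_pairing [RHS]surjective_pairing /= mul1r.
congr pair; have [_|g0] := eqVneq g 0; first by rewrite mul1r.
by rewrite mul0r (SpatP _ (valP s)) // -entrydeg_eq0 ij.
Qed.

Lemma Seps_mull g s : Sgrading g s -> Seps g * s = s.
Proof.
move=> Ss; apply: val_inj; apply/matrixP => i j.
by rewrite valM mul_scalar_mx mxE entry1_entry.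
Qed.

Lemma Seps_mulr g s : Sgrading g s -> s * Seps g^-1%g = s.
Proof.
move=> Ss; rewrite Z2_invg; apply: val_inj; apply/matrixP => i j.
by rewrite valM mul_mx_scalar mxE entry1_entry.
Qed.

(** Every row k has a column c with entry (k, c) of degree g. As E_kc E_ck is
    E_kk, the local unit, which is the sum over k of the E_kk with coefficient
    [entry1 g], is a sum of products of matrix units with that coefficient. *)
Lemma Seps_prod g : (Sgrading g ⊙ Sgrading g^-1%g) (Seps g).
Proof.
have [c deg_c] : exists c : 'I_3 -> 'I_3, forall k, entrydeg k (c k) = g.
  case: (Z2_cases g) => ->.
    by exists id => k; rewrite /entrydeg mulgV.
  exists (fun k => if k == 2%N :> nat then 0 else inord 2) => k.
  by rewrite /entrydeg /rowdeg; case: eqP => _; rewrite ?inordK //;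
    apply: val_inj.
exists 3%N, (fun k => Sunit k (c k)), (fun k => Sunit (c k) k); split=> [k|k|].
- exact: Sunit_deg.
- by apply: Sunit_deg; rewrite -entrydegV deg_c.
apply: val_inj; rewrite val_sum [LHS]scalar_mx_sum_delta.
apply: eq_bigr => k _; rewrite valM.
rewrite -scalemxAl -scalemxAr scalerA mul_delta_mx -(entrydegV k) deg_c.
by rewrite Z2_invg entry1_idem.
Qed.

Lemma sum_Seps : \sum_g Seps g = Sscalar (1 + 1, 1).
Proof.
apply: val_inj; rewrite val_sum big_ord_recl big_ord1 /= -raddfD.
by congr (_%:M); congr pair => /=; rewrite addr0.
Qed.

(** The first component of the entry (0, 0) of an inverse is an inverse of 2;
    conversely the inverse of the scalar (2, 1) gives a scalar matrix, which
    lies in R. *)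
Lemma invertible_sum_Seps :
  invertible_in (@Rset F) (\sum_g Seps g) <-> 2%N \notin [pchar F].
Proof.
rewrite sum_Seps inE /= mulr2n; split=> [[_ [y _ [inv_y _]]]|two].
  apply/eqP => two; have /(congr1 (fun s => (val s 0 0).1)) := inv_y.
  rewrite valM mul_scalar_mx !mxE /= two mul0r => /eqP.
  by rewrite eq_sym oner_eq0.
split; first exact: Sscalar_R.
exists (Sscalar ((1 + 1)^-1, 1)); first exact: Sscalar_R.
by rewrite !SscalarM -Sscalar1; split; congr Sscalar; congr pair => /=;
  rewrite ?mulr1 ?mulfV ?mulVf.
Qed.

End Example.

Theorem proposition39 (F : fieldType) :
  is_epsilon_strong_grading (@Sgrading F) /\
  forall (eps : 'Z_2 -> Smx F) (n : 'Z_2 -> nat)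
         (u v : forall g : 'Z_2, 'I_(n g) -> Smx F),
    is_epsilon_decomposition (@Sgrading F) eps u v ->
    (invertible_in (@Rset F) (tr_gamma u v 1) <-> 2%N \notin [pchar F]).
Proof.
split=> [|eps n u v dec].
  apply: (epsilon_strongI (eps := @Seps F)).
  - exact: Sgrading_is_grading.
  - exact: Seps_prod.
  - exact: Seps_mull.
  - exact: Seps_mulr.
rewrite (tr_gamma1 (@Seps_prod F) (@Seps_mull F) (@Seps_mulr F) dec).
exact: invertible_sum_Seps.
Qed.
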